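(* Let $f:[a,b]\times[c,d]\to\mathbb{R}$ be an absolutely continuous function such that the partial derivative of order $2$, $\frac{\partial^2 f(t,s)}{\partial t\,\partial s}$, exists for all $(t,s)\in[a,b]\times[c,d]$ and is bounded, i.e. $$\left\Vert \frac{\partial^2 f(t,s)}{\partial t\,\partial s}\right\Vert_\infty=\sup_{(t,s)\in(a,b)\times(c,d)}\left|\frac{\partial^2 f(t,s)}{\partial t\,\partial s}\right|<\infty .$$ Then, for $(x,y)\in[a,b]\times[c,d]$, $$\left| f(x,y)-\left[\frac{1}{m(a,b)}\int_a^b w(t)f(t,y)\,dt+\frac{1}{m(c,d)}\int_c^d w(s)f(x,s)\,ds\right]-\frac{1}{m(a,b)m(c,d)}\int_a^b\int_c^d w(s)w(t)f(t,s)\,ds\,dt\right|$$ $$\le \frac{A(x)B(y)}{m(a,b)m(c,d)}\left\Vert \frac{\partial^2 f(t,s)}{\partial t\,\partial s}\right\Vert_\infty ,$$ where $$A(x)=\int_a^x (x-u)w(u)\,du+\int_x^b (u-x)w(u)\,du,\qquad B(y)=\int_c^y (y-u)w(u)\,du+\int_y^d (u-y)w(u)\,du .$$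
   Context: Here $a<b$ and $c<d$ are real numbers. The weight function $w$, defined on $[a,b]$ and on $[c,d]$ with values in $[0,\infty)$, is integrable and nonnegative, and $m(p,q)=\int_p^q w(u)\,du$, with $m(a,b)<\infty$ and $m(c,d)<\infty$.
   Formalization: The double-integral term enters with sign + (inside the bracket), since the printed sign − fails for f = 1, w = 1 on the unit square (2 ≤ 0); m(a,b) and m(c,d) are assumed nonzero so that the quotients make sense. *)

(* Defs.v *)
From HB Require Import structures.
From mathcomp Require Import all_boot all_order all_algebra.
From mathcomp Require Import all_classical all_reals all_analysis.

Set Implicit Arguments.
Unset Strict Implicit.
Unset Printing Implicit Defensive.

Import Order.TTheory GRing.Theory Num.Theory.
Import numFieldNormedType.Exports.

Local Open Scope classical_set_scope.
Local Open Scope ring_scope.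

(* A function on [a, b] x [c, d] is represented by a total f : R -> R -> R;
   every notion below only depends on its values on the rectangle. *)

(* Derivatives relative to a set D: on a closed interval they are the usual
   derivatives at interior points and the one-sided ones at the endpoints. *)
Definition derivable_within (R : realType) (D : set R) (g : R -> R) (x : R) :
    Prop :=
  cvg ((fun y => (g y - g x) / (y - x)) @ within D x^').

Definition derive_within (R : realType) (D : set R) (g : R -> R) (x : R) : R :=
  lim ((fun y => (g y - g x) / (y - x)) @ within D x^').

Definition partial_s (R : realType) (c d : R) (f : R -> R -> R) (t s : R) : R :=
  derive_within `[c, d] (f t) s.

(* d^2 f / dt ds = d/dt (df/ds). *)
Definition partial_ts (R : realType) (a b c d : R) (f : R -> R -> R)
    (t s : R) : R :=
  derive_within `[a, b] (fun t' => partial_s c d f t' s) t.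

Definition has_partial_ts (R : realType) (a b c d : R) (f : R -> R -> R)
    (t s : R) : Prop :=
  derivable_within `[c, d] (f t) s /\
  derivable_within `[a, b] (fun t' => partial_s c d f t' s) t.

Definition norm_partial_ts (R : realType) (a b c d : R) (f : R -> R -> R) :
    \bar R :=
  ereal_sup [set (`|partial_ts a b c d f z.1 z.2|)%:E
            | z in `]a, b[%classic `*` `]c, d[%classic].

Definition abs_continuous1 (R : realType) (a b : R) (g : R -> R) : Prop :=
  forall e : R, 0 < e -> exists2 delta : R, 0 < delta &
    forall (n : nat) (p q : 'I_n -> R),
      (forall i, a <= p i /\ p i <= q i /\ q i <= b) ->
      (forall i j, i != j ->
         `]p i, q i[%classic `&` `]p j, q j[%classic = set0) ->
      \sum_(i < n) (q i - p i) < delta ->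
      \sum_(i < n) `|g (q i) - g (p i)| < e.

(* Absolute continuity in two variables in the sense of Caratheodory: a
   condition on the rectangular increments over finite families of
   non-overlapping rectangles, and absolute continuity of f along two sides
   (the increments alone do not see functions of a single variable). *)
Definition abs_continuous2 (R : realType) (a b c d : R) (f : R -> R -> R) :
    Prop :=
  [/\ forall e : R, 0 < e -> exists2 delta : R, 0 < delta &
        forall (n : nat) (p q r s : 'I_n -> R),
          (forall i, a <= p i /\ p i <= q i /\ q i <= b) ->
          (forall i, c <= r i /\ r i <= s i /\ s i <= d) ->
          (forall i j, i != j ->
             (`]p i, q i[%classic `*` `]r i, s i[%classic) `&`
             (`]p j, q j[%classic `*` `]r j, s j[%classic) = set0) ->
          \sum_(i < n) ((q i - p i) * (s i - r i)) < delta ->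
          \sum_(i < n) `|f (q i) (s i) - f (p i) (s i)
                         - f (q i) (r i) + f (p i) (r i)| < e,
      abs_continuous1 a b (fun t => f t c) &
      abs_continuous1 c d (f a)].

Definition mass (R : realType) (w : R -> R) (p q : R) : R :=
  \int[@lebesgue_measure R]_(u in `[p, q]) w u.

(* A(x) = abs_moment w a b x and B(y) = abs_moment w c d y. *)
Definition abs_moment (R : realType) (w : R -> R) (p q x : R) : R :=
  \int[@lebesgue_measure R]_(u in `[p, x]) ((x - u) * w u) +
  \int[@lebesgue_measure R]_(u in `[x, q]) ((u - x) * w u).

(* Main.v *)
Require Import Defs.
From HB Require Import structures.
From mathcomp Require Import all_boot all_order all_algebra.
From mathcomp Require Import all_classical all_reals all_analysis.
From mathcomp Require Import ring lra.
Import Order.TTheory GRing.Theory Num.Theory.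
Import numFieldNormedType.Exports.

Set Implicit Arguments.
Unset Strict Implicit.
Unset Printing Implicit Defensive.

Local Open Scope classical_set_scope.
Local Open Scope ring_scope.

(* Two applications of the mean value theorem, first in s and then in t, bound
   the rectangular increment f(x,y) - f(t,y) - f(x,s) + f(t,s) by M |x-t| |y-s|.
   Integrating a bound |g(x) - g(t)| <= K |x-t| against w(t) gives
   |m(a,b) g(x) - int w g| <= K A(x).  For g = f(x,.) - f(t,.) this says that
   H(t) = m(c,d) f(t,y) - int w(s) f(t,s) ds is Lipschitz with constant M B(y);
   the same estimate applied to g = H yields the theorem, without Fubini.
   Absolute continuity of f only serves to make f(.,y), hence w f(.,y),
   integrable. *)

(** * Derivatives relative to a set, and continuity within it *)

Lemma derivable_withinP (R : realType) (D : set R) (g : R -> R) (x : R) :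
  derivable_within D g x -> forall e : R, 0 < e -> exists2 delta : R, 0 < delta &
    forall y, D y -> y != x -> `|x - y| < delta ->
      `|derive_within D g x - (g y - g x) / (y - x)| < e.
Proof.
move=> dg e e0.
have /cvgrPdist_lt /(_ _ e0) := dg.
rewrite /prop_near1 /within /dnbhs /within /= => /nbhs_normP[delta d0 H].
by exists delta => // y Dy yx xy; apply: H.
Qed.

(** Small increments from an interior point stay in [[u, v]], so restricting the limit to the
    interval changes nothing. This supplies the two-sided derivative that the mean value theorem
    asks for. *)
Lemma derivable_within_is_derive (R : realType) (u v : R) (g : R -> R) (x : R) :
  x \in `]u, v[ -> derivable_within `[u, v] g x ->
  is_derive x 1 g (derive_within `[u, v] g x).
Proof.
rewrite in_itv/= => /andP[ux xv] /derivable_withinP dg.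
suff H : (fun h => h^-1 *: ((g \o shift x) (h *: 1) - g x)) @ 0^' -->
    derive_within `[u, v] g x.
  by split; [apply/cvg_ex; eexists; exact: H | exact: cvg_lim H].
apply/cvgrPdist_lt => e e0.
have [delta d0 H] := dg _ e0.
near=> h.
have h0 : h != 0 by near: h; exact: nbhs_dnbhs_neq.
have hd : `|h| < delta by near: h; exact: dnbhs0_lt.
have hu : `|h| < x - u by near: h; apply: dnbhs0_lt; rewrite subr_gt0.
have hv : `|h| < v - x by near: h; apply: dnbhs0_lt; rewrite subr_gt0.
have /ltr_normlP[hu' _] := hu; have /ltr_normlP[_ hv'] := hv.
have := H (h + x).
rewrite addrK /shift /= [h%:A]mulr1 [h^-1 *: _]mulrC; apply.
- by rewrite in_itv/=; lra.
- by rewrite -subr_eq0 addrK.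
- by rewrite opprD addrCA subrr addr0 normrN.
Unshelve. all: by end_near. Qed.

Lemma within_continuousP (R : realType) (D : set R) (g : R -> R) :
  (forall x, D x -> forall e : R, 0 < e -> exists2 delta : R, 0 < delta &
    forall y, D y -> `|x - y| < delta -> `|g x - g y| < e) ->
  {within D, continuous g}.
Proof.
move=> H; apply/subspace_continuousP => x Dx; apply/cvgrPdist_lt => e e0.
have [delta d0 Hd] := H _ Dx _ e0.
apply/nbhs_normP; exists delta => // y /= xy Dy; exact: Hd.
Qed.

Lemma derivable_within_continuous (R : realType) (D : set R) (g : R -> R) :
  (forall x, D x -> derivable_within D g x) -> {within D, continuous g}.
Proof.
move=> dg; apply: within_continuousP => x Dx e e0.
have [delta d0 H] := derivable_withinP (dg _ Dx) ltr01.
set L := derive_within D g x in H.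
have L0 : 0 < `|L| + 1 by rewrite ltr_wpDl.
(* Closer than [delta], the difference quotient differs from [L] by less than 1, so g changes by at
   most (|L| + 1) |x - y|; the second radius makes this less than [e]. *)
exists (Num.min delta (e / (`|L| + 1))); first by rewrite lt_min d0 divr_gt0.
move=> y Dy; rewrite lt_min => /andP[yd ye].
have [->|yx] := eqVneq y x; first by rewrite subrr normr0.
have {}H := H _ Dy yx yd.
have -> : g x - g y = (g y - g x) / (y - x) * (x - y).
  by field; rewrite subr_eq0.
rewrite normrM; apply: le_lt_trans (_ : (`|L| + 1) * `|x - y| < e); last first.
  by rewrite mulrC -ltr_pdivlMr.
rewrite ler_wpM2r//; apply: le_trans (_ : `|L| + `|L - (g y - g x) / (y - x)| <= _).
  by rewrite -{1}[_ / _](subKr L) (le_trans (ler_normB _ _)).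
by rewrite lerD2l ltW.
Qed.

(** * Mean value inequalities in one and two variables *)

Lemma MVT_le (R : realType) (u v K : R) (g dg : R -> R) :
  (forall z, z \in `]u, v[ -> is_derive z 1 g (dg z)) ->
  {within `[u, v], continuous g} ->
  (forall z, z \in `]u, v[ -> `|dg z| <= K) ->
  forall p q, p \in `[u, v] -> q \in `[u, v] -> `|g p - g q| <= K * `|p - q|.
Proof.
move=> gd gc gK.
suff H p q : u <= p -> p < q -> q <= v -> `|g q - g p| <= K * `|q - p|.
  move=> p q; rewrite !in_itv/= => /andP[up pv] /andP[uq qv].
  have [pq|pq|->] := ltgtP p q; last by rewrite !subrr normr0 mulr0.
    by rewrite distrC (distrC p); exact: H.
  exact: H.
move=> up pq qv.
have uv z : z \in `]p, q[ -> z \in `]u, v[.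
  by rewrite !in_itv/= => /andP[? ?]; apply/andP; split; lra.
have gcpq : {within `[p, q], continuous g}.
  by apply: (continuous_subspaceW _ gc); apply: subset_itv; rewrite bnd_simp.
have gdpq z : z \in `]p, q[ -> is_derive z 1 g (dg z) by move=> /uv; exact: gd.
have [z zpq ->] := MVT pq gdpq gcpq.
by rewrite normrM ler_wpM2r// gK// uv.
Qed.

Lemma derivable_within_lip (R : realType) (u v K : R) (g : R -> R) :
  (forall z, z \in `[u, v] -> derivable_within `[u, v] g z) ->
  (forall z, z \in `]u, v[ -> `|derive_within `[u, v] g z| <= K) ->
  forall p q, p \in `[u, v] -> q \in `[u, v] -> `|g p - g q| <= K * `|p - q|.
Proof.
move=> dg; apply: MVT_le; last exact: derivable_within_continuous.
move=> z zuv; apply: derivable_within_is_derive => //; apply: dg.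
exact: subset_itv_oo_cc.
Qed.

Lemma rect_increment_le (R : realType) (a b c d K : R) (f : R -> R -> R) :
  (forall t s, t \in `[a, b] -> s \in `[c, d] -> has_partial_ts a b c d f t s) ->
  (forall t s, t \in `]a, b[ -> s \in `]c, d[ ->
     `|partial_ts a b c d f t s| <= K) ->
  forall x t y s, x \in `[a, b] -> t \in `[a, b] ->
    y \in `[c, d] -> s \in `[c, d] ->
  `|(f x y - f t y) - (f x s - f t s)| <= K * `|x - t| * `|y - s|.
Proof.
move=> fts fK x t y s xab tab ycd scd.
(* The derivative in s of f(x,s) - f(t,s) is an increment in t of df/ds, which a second mean value
   estimate bounds by K |x - t|. Both estimates use derivative bounds at interior points only, as
   [fK] covers just the open rectangle. *)
apply: (@MVT_le R c d (K * `|x - t|) (fun s => f x s - f t s)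
  (fun s => partial_s c d f x s - partial_s c d f t s)) ycd scd.
- move=> z zcd; have zcc := subset_itv_oo_cc zcd.
  by apply: is_deriveB; apply: derivable_within_is_derive zcd _;
    [exact: (fts x z _ _).1 | exact: (fts t z _ _).1].
- have := @derivable_within_continuous R `[c, d] (f x)
    (fun z zc => (fts x z xab zc).1).
  have := @derivable_within_continuous R `[c, d] (f t)
    (fun z zc => (fts t z tab zc).1).
  by move=> ct cx z; exact: (continuousB (cx z) (ct z)).
- move=> z zcd; have zcc := subset_itv_oo_cc zcd.
  apply: (@derivable_within_lip R a b K (fun t => partial_s c d f t z)) => //.
    by move=> p pab; exact: (fts p z _ _).2.
  by move=> p pab; exact: fK.
Qed.

Lemma abs_continuous1_continuous (R : realType) (a b : R) (g : R -> R) :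
  abs_continuous1 a b g -> {within `[a, b], continuous g}.
Proof.
move=> ac; apply: within_continuousP => x xab e e0.
have [delta d0 H] := ac _ e0; exists delta => // y yab xy.
move: xab yab; rewrite /= !in_itv/= => /andP[ax xb] /andP[ay yb].
(* A family consisting of the single interval between x and y, for which disjointness is vacuous. *)
have := H 1 (fun=> Num.min x y) (fun=> Num.max x y).
rewrite !big_ord1 => {}H.
have {H} : `|g (Num.max x y) - g (Num.min x y)| < e.
  apply: H.
  - by move=> _; rewrite le_min ge_max ge_min le_max ax ay xb yb !lexx.
  - by move=> i j; rewrite !ord1 eqxx.
  - by case: (leP x y) xy => ? /ltr_normlP[]; lra.
by case: (leP x y) => // _; rewrite distrC.
Qed.

(** * Integrals against the weight *)

Lemma integrable_weightM (R : realType) (a b : R) (w : R -> R) (g : R -> R) :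
  (@lebesgue_measure R).-integrable `[a, b] (EFin \o w) ->
  {within `[a, b], continuous g} ->
  (@lebesgue_measure R).-integrable `[a, b] (EFin \o (fun t => w t * g t)).
Proof.
move=> w_int gc; have mI : measurable (`[a, b]%classic : set (measurableTypeR R)).
  exact: measurable_itv.
apply: (@integrableMl _ (measurableTypeR R) R _ _ mI _ g w_int).
  exact: measurable_realfun.subspace_continuous_measurable_fun.
(* Continuity on a compact interval bounds [g]; a bounded measurable factor preserves
   integrability. *)
have /compact_bounded[M [_ mrt]] := continuous_compact gc (@segment_compact R a b).
by exists M; split; rewrite ?num_real // => ? ? ? ?; exact: mrt.
Qed.

Lemma abs_momentE (R : realType) (a b : R) (w : R -> R) (x : R) :
  (@lebesgue_measure R).-integrable `[a, b] (EFin \o w) ->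
  x \in `[a, b] ->
  abs_moment w a b x =
    \int[@lebesgue_measure R]_(t in `[a, b]) (w t * `|x - t|).
Proof.
move=> w_int; rewrite in_itv/= => /andP[ax xb].
have ci : lebesgue_measure.-integrable `[a, b] (EFin \o (fun t => w t * `|x - t|)).
  apply: integrable_weightM w_int _; apply: continuous_subspaceT => t.
  apply: cvg_norm; apply: cvgB; [exact: cvg_cst | exact: cvg_id].
(* Cutting at x leaves the half-open piece from x to b; its missing endpoint has measure zero. On
   each piece |x - t| has a constant sign. *)
have := @Rintegral_itvB R _ (BLeft a) (BRight b) x ci.
rewrite !bnd_simp => /(_ ax xb)/eqP; rewrite subr_eq => /eqP ->.
rewrite Rintegral_itv_obnd_cbnd; last first.
  by apply: integrableS ci => //; apply: subset_itvr; rewrite bnd_simp.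
rewrite /abs_moment addrC; congr (_ + _); apply: eq_Rintegral => t;
  rewrite inE/= in_itv/= => /andP[? ?]; rewrite mulrC; congr (_ * _).
  by rewrite ler0_norm ?opprB// subr_le0.
by rewrite ger0_norm ?subr_ge0.
Qed.

(** As m(a,b) g(x) is the integral of w(t) g(x), the left side is the absolute value of the integral
    of w(t) (g(x) - g(t)), and the bound on g applies under the integral. No division by the mass
    occurs, so the estimate can be iterated before normalising. *)
Lemma weighted_mean_le (R : realType) (a b : R) (w : R -> R) (g : R -> R) (K x : R) :
  (forall u, u \in `[a, b] -> 0 <= w u) ->
  (@lebesgue_measure R).-integrable `[a, b] (EFin \o w) ->
  x \in `[a, b] ->
  {within `[a, b], continuous g} ->
  (forall t, t \in `[a, b] -> `|g x - g t| <= K * `|x - t|) ->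
  `|mass w a b * g x - \int[@lebesgue_measure R]_(t in `[a, b]) (w t * g t)|
    <= K * abs_moment w a b x.
Proof.
move=> w_ge0 w_int xab gc gK.
have wi (h : R -> R) (hc : {within `[a, b], continuous h}) :=
  integrable_weightM w_int hc.
have cc (k : R) : {within `[a, b], continuous (fun=> k)}.
  by apply: continuous_subspaceT => ?; exact: cvg_cst.
have nc : {within `[a, b], continuous (fun t => `|x - t|)}.
  apply: continuous_subspaceT => t.
  by apply: cvg_norm; apply: cvgB; [exact: cvg_cst | exact: cvg_id].
rewrite abs_momentE// -RintegralZr// -RintegralB//; [|exact: wi..].
have -> : \int[@lebesgue_measure R]_(t in `[a, b]) (w t * g x - w t * g t) =
    \int[@lebesgue_measure R]_(t in `[a, b]) (w t * (g x - g t)).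
  by apply: eq_Rintegral => t _; rewrite mulrBr.
have dc : {within `[a, b], continuous (fun t => g x - g t)}.
  by move=> z; exact: (continuousB (cc (g x) z) (gc z)).
apply: le_trans (le_normr_Rintegral _ _) _ => //; first exact: wi.
rewrite -RintegralZl//; last exact: wi.
apply: le_Rintegral => //.
- rewrite [X in _.-integrable _ X](_ : _ =
    abse \o (EFin \o (fun t => w t * (g x - g t))))//.
  by apply: integrable_abse; exact: wi.
- rewrite [X in _.-integrable _ X](_ : _ =
    (cst K%:E \* (EFin \o (fun t => w t * `|x - t|)%R))%E)//.
  by apply: integrableZl => //; exact: wi.
- move=> t /= tab; rewrite normrM ger0_norm ?w_ge0// mulrCA.
  by rewrite ler_wpM2l ?w_ge0// gK.
Qed.

Lemma mass_ge0 (R : realType) (a b : R) (w : R -> R) :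
  (forall u, u \in `[a, b] -> 0 <= w u) -> 0 <= mass w a b.
Proof. by move=> w_ge0; apply: Rintegral_ge0 => u; exact: w_ge0. Qed.

Lemma lip_within_continuous (R : realType) (D : set R) (g : R -> R) (K : R) :
  (forall x y, D x -> D y -> `|g x - g y| <= K * `|x - y|) ->
  {within D, continuous g}.
Proof.
move=> gK; apply: within_continuousP => x Dx e e0.
(* The divisor is |K| + 1 because [K] may be zero or negative. *)
have L0 : 0 < `|K| + 1 by rewrite ltr_wpDl.
exists (e / (`|K| + 1)); first by rewrite divr_gt0.
move=> y Dy; rewrite ltr_pdivlMr// => xy; apply: le_lt_trans (gK _ _ Dx Dy) _.
apply: le_lt_trans xy; rewrite mulrC ler_wpM2l//.
by rewrite (le_trans (ler_norm _))// lerDl.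
Qed.

Lemma norm_partial_tsP (R : realType) (a b c d : R) (f : R -> R -> R) :
  a < b -> c < d -> (norm_partial_ts a b c d f < +oo)%E ->
  exists2 M : R, norm_partial_ts a b c d f = M%:E &
    forall t s, t \in `]a, b[ -> s \in `]c, d[ ->
      `|partial_ts a b c d f t s| <= M.
Proof.
move=> ab cd foo.
have ub t s : t \in `]a, b[ -> s \in `]c, d[ ->
    (`|partial_ts a b c d f t s|%:E <= norm_partial_ts a b c d f)%E.
  by move=> tab scd; apply: ereal_sup_ubound; exists (t, s).
(* The value at the midpoint of the rectangle rules out a supremum equal to -oo. *)
have := ub _ _ (mid_in_itvoo ab) (mid_in_itvoo cd).
move: foo ub; case: norm_partial_ts => // M _ ub _; by exists M.
Qed.

Theorem theorem3 (R : realType) (a b c d : R) (w : R -> R) (f : R -> R -> R)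
  (hab : a < b) (hcd : c < d)
  (w_ge0_ab : forall u, u \in `[a, b] -> 0 <= w u)
  (w_ge0_cd : forall u, u \in `[c, d] -> 0 <= w u)
  (w_int_ab : (@lebesgue_measure R).-integrable `[a, b] (EFin \o w))
  (w_int_cd : (@lebesgue_measure R).-integrable `[c, d] (EFin \o w))
  (mab_neq0 : mass w a b != 0) (mcd_neq0 : mass w c d != 0)
  (f_ac : abs_continuous2 a b c d f)
  (f_ts : forall t s, t \in `[a, b] -> s \in `[c, d] ->
     has_partial_ts a b c d f t s)
  (f_ts_bounded : (norm_partial_ts a b c d f < +oo)%E)
  (x y : R) (hx : x \in `[a, b]) (hy : y \in `[c, d]) :
  ((`| f x y
       - ((mass w a b)^-1 *
            (\int[@lebesgue_measure R]_(t in `[a, b]) (w t * f t y))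
          + (mass w c d)^-1 *
            (\int[@lebesgue_measure R]_(s in `[c, d]) (w s * f x s))
          - (mass w a b * mass w c d)^-1 *
            (\int[@lebesgue_measure R]_(t in `[a, b])
               (\int[@lebesgue_measure R]_(s in `[c, d])
                  (w s * w t * f t s)))) |)%:E
   <= (abs_moment w a b x * abs_moment w c d y
        / (mass w a b * mass w c d))%:E
      * norm_partial_ts a b c d f)%E.

Proof.
have [M -> fM] := norm_partial_tsP hab hcd f_ts_bounded.
have f_incr := rect_increment_le f_ts fM.
have fc t : t \in `[a, b] -> {within `[c, d], continuous (f t)}.
  by move=> tab; apply: derivable_within_continuous => s scd; exact: (f_ts t s _ _).1.
(* The differentiability assumptions say nothing of f(.,y) itself. It is the sum of f(.,c),
   continuous by absolute continuity along that side, and of f(.,y) - f(.,c), Lipschitz by the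
   increment bound. *)
have fyc : {within `[a, b], continuous (f^~ y)}.
  have ccd : c \in `[c, d] by rewrite in_itv/= lexx ltW.
  have gc : {within `[a, b], continuous (fun t => f t y - f t c)}.
    apply: (@lip_within_continuous _ _ _ (M * `|y - c|)) => t t' tab tab'.
    have := f_incr t t' y c tab tab' hy ccd.
    by rewrite mulrAC; congr (`|_| <= _); ring.
  have [_ /abs_continuous1_continuous hc _] := f_ac.
  have -> : f^~ y = (fun t => f t c + (f t y - f t c)).
    by apply/funext => t; rewrite addrC subrK.
  by move=> t; exact: (continuousD (hc t) (gc t)).
set F := fun t => \int[@lebesgue_measure R]_(s in `[c, d]) (w s * f t s).
pose H t := mass w c d * f t y - F t.
have H_lip t t' : t \in `[a, b] -> t' \in `[a, b] ->
    `|H t - H t'| <= M * abs_moment w c d y * `|t - t'|.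
  move=> tab tab'.
  have dc : {within `[c, d], continuous (fun s => f t s - f t' s)}.
    by move=> s; exact: (continuousB (fc t tab s) (fc t' tab' s)).
  (* By linearity this is the weighted deviation at y of f(t,.) - f(t',.), which satisfies the
     Lipschitz bound at y with constant M |t - t'|. *)
  have -> : H t - H t' = mass w c d * (f t y - f t' y) -
      \int[@lebesgue_measure R]_(s in `[c, d]) (w s * (f t s - f t' s)).
    rewrite /H /F [in RHS](_ : \int[@lebesgue_measure R]_(s in `[c, d])
        (w s * (f t s - f t' s)) =
      \int[@lebesgue_measure R]_(s in `[c, d]) (w s * f t s - w s * f t' s)).
      rewrite RintegralB//; [ring|exact: integrable_weightM (fc _ _)..].
    by apply: eq_Rintegral => s _; rewrite mulrBr.
  rewrite mulrAC; apply: (weighted_mean_le w_ge0_cd w_int_cd hy dc) => s scd.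
  exact: f_incr.
have Hc : {within `[a, b], continuous H} by exact: lip_within_continuous H_lip.
have mfyc : {within `[a, b], continuous (fun t => mass w c d * f t y)}.
  by move=> t; apply: continuousM (fyc t); exact: cst_continuous.
(* Continuity of the parameter integral [F] follows from that of [H], with no convergence theorem
   under the integral sign. *)
have Fc : {within `[a, b], continuous F}.
  have -> : F = (fun t => mass w c d * f t y - H t).
    by apply/funext => t; rewrite /H subKr.
  by move=> t; exact: (continuousB (mfyc t) (Hc t)).
have := weighted_mean_le w_ge0_ab w_int_ab hx Hc (fun t => H_lip x t hx).
have -> : \int[@lebesgue_measure R]_(t in `[a, b]) (w t * H t) =
   mass w c d * (\int[@lebesgue_measure R]_(t in `[a, b]) (w t * f t y))
   - \int[@lebesgue_measure R]_(t in `[a, b]) (w t * F t).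
  rewrite -RintegralZl//; last exact: integrable_weightM.
  rewrite -RintegralB//; last 2 first.
  - rewrite [X in _.-integrable _ X](_ : _ = EFin \o
      (fun t => w t * (mass w c d * f t y))); first exact: integrable_weightM.
    by apply/funext => t /=; rewrite mulrCA.
  - exact: integrable_weightM.
  by apply: eq_Rintegral => t _; rewrite /H; ring.
(* The factor w(t) is constant for the inner integral, so the order of integration is kept. *)
have -> : \int[@lebesgue_measure R]_(t in `[a, b])
    (\int[@lebesgue_measure R]_(s in `[c, d]) (w s * w t * f t s)) =
    \int[@lebesgue_measure R]_(t in `[a, b]) (w t * F t).
  apply: eq_Rintegral => t; rewrite inE => tab.
  rewrite /F -RintegralZl//; last exact: integrable_weightM (fc _ _).
  by apply: eq_Rintegral => s _; ring.
rewrite /H -/(F x) -EFinM lee_fin.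
set m1 := mass w a b in mab_neq0 *; set m2 := mass w c d in mcd_neq0 *.
have m_gt0 : 0 < m1 * m2.
  by rewrite mulr_gt0// lt_neqAle eq_sym ?mab_neq0 ?mcd_neq0 mass_ge0.
(* Multiplying the goal by m1 m2 > 0, moved inside the absolute value, turns its left side into that
   of [hle]. *)
move=> hle; rewrite mulrAC ler_pdivlMr// -[X in _ * X <= _](gtr0_norm m_gt0) -normrM.
move: hle; congr (is_true (`|_| <= _)); last by ring.
by rewrite /F; field; rewrite mab_neq0 mcd_neq0.
Qed.
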